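(* Let $0<p<1$, let $\{X_n,\ n\ge1\}$ be the steps of the elephant random walk that remembers only the first two steps and the most recent step, with $P(X_1=1)=p=1-P(X_1=-1)$, let $S_n=\sum_{k=1}^n X_k$, and let $$\sigma_T^2=1+\frac{(2p-1)(5-5p-p^2)}{(2-p)^3}.$$ Then, as $n\to\infty$, $$\frac{S_n-\frac{(2p-1)(X_1+X_2)/2}{2-p}\,n}{\sqrt n}$$ converges in distribution to the mixture $p\cdot\mathcal N_{0,\sigma_T^2}+(1-p)\cdot\mathcal N_{0,(1+p)/(2-p)}$.
   Context: Elephant random walk remembering only the first two steps and the most recent step: $X_2=X_1$ with probability $p$ and $X_2=-X_1$ with probability $1-p$; for $n=2$ choose $K$ uniformly on $\{1,2\}$, and for every $n\ge3$ choose $K$ uniformly on $\{1,2,n\}$; then set $X_{n+1}=X_K$ with probability $p$ and $X_{n+1}=-X_K$ with probability $1-p$. All index choices and sign choices are mutually independent and independent of $X_1$. $\mathcal N_{0,\sigma^2}$ denotes the distribution function of the normal law with mean $0$ and variance $\sigma^2$; a convex combination of such distribution functions denotes the corresponding mixture distribution. *)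

(* Defs.v *)
From HB Require Import structures.
From mathcomp Require Import all_boot all_order all_algebra finmap.
From mathcomp Require Import all_classical all_reals all_analysis.
From mathcomp Require Import measurable_realfun.

Set Implicit Arguments.
Unset Strict Implicit.
Unset Printing Implicit Defensive.

Import Order.TTheory GRing.Theory Num.Theory.
Import numFieldNormedType.Exports.

Local Open Scope classical_set_scope.
Local Open Scope ring_scope.

Definition mutually_independent d (T : measurableType d) (R : realType)
    (P : probability T R) (I : choiceType) (E : I -> set (set T)) : Prop :=
  forall (J : {fset I}) (A : I -> set T),
    (forall i, i \in J -> E i (A i)) ->
    P (\bigcap_(i in [set` J]) A i) = (\prod_(i <- J) P (A i))%E.

Definition sigma_of d d' (T : measurableType d) (T' : measurableType d')
    (f : T -> T') : set (set T) :=
  preimage_set_system [set: T] f measurable.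

Definition sign_law d (T : measurableType d) (R : realType)
    (P : probability T R) (p : R) (Y : {RV P >-> R}) : Prop :=
  P [set w | Y w = 1] = p%:E /\ P [set w | Y w = -1] = (1 - p)%:E.

(* [s] is meant to be duplicate-free. *)
Definition uniform_on d (T : measurableType d) (R : realType)
    (P : probability T R) (s : seq nat) (K : {RV P >-> nat}) : Prop :=
  forall k, k \in s -> P [set w | K w = k] = ((size s)%:R^-1)%:E.

Section elephant.
Context d (T : measurableType d) (R : realType) (P : probability T R).

(* The index shifts keep only the choices that are used: memory choices
   K_2, K_3, ... and sign choices eps_1, eps_2, ... *)
Definition erw_sources (X : nat -> {RV P >-> R}) (K : nat -> {RV P >-> nat})
    (eps : nat -> {RV P >-> R}) (i : option (nat + nat)) : set (set T) :=
  match i with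
  | None => sigma_of (X 1%N)
  | Some (inl n) => sigma_of (K n.+2)
  | Some (inr n) => sigma_of (eps n.+1)
  end.

(* Steps are numbered from 1, and [X 0], [K 0], [K 1], [eps 0] are
   unconstrained; [K n] and [eps n] produce the step [X n.+1]. *)
Record elephant_first_two_last (p : R) (X : nat -> {RV P >-> R})
    (K : nat -> {RV P >-> nat}) (eps : nat -> {RV P >-> R}) : Prop := {
  erw_first : sign_law p (X 1%N) ;
  erw_sign : forall n, (1 <= n)%N -> sign_law p (eps n) ;
  erw_memory2 : uniform_on [:: 1; 2]%N (K 2%N) ;
  erw_memory : forall n, (3 <= n)%N -> uniform_on [:: 1; 2; n]%N (K n) ;
  erw_independent : mutually_independent P (erw_sources X K eps) ;
  erw_step2 : forall w, X 2%N w = eps 1%N w * X 1%N w ;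
  erw_step : forall n, (2 <= n)%N ->
    forall w, X n.+1 w = eps n w * X (K n w) w }.

Definition erw_position (X : nat -> {RV P >-> R}) (n : nat) : T -> R :=
  fun w => \sum_(1 <= k < n.+1) X k w.

Definition erw_normalized (p : R) (X : nat -> {RV P >-> R}) (n : nat) : T -> R :=
  fun w => (erw_position X n w
            - ((2 * p - 1) * ((X 1%N w + X 2%N w) / 2)) / (2 - p) * n%:R)
           / Num.sqrt n%:R.

Lemma measurable_erw_normalized p X n :
  measurable_fun [set: T] (erw_normalized p X n).
Proof.
apply: measurable_funM => //; apply: measurable_funB.
  by apply: measurable_sum => k; exact: measurable_funPT.
apply: measurable_funM => //; apply: measurable_funM => //.
apply: measurable_funM => //; apply: measurable_funM => //.
by apply: measurable_funD; exact: measurable_funPT.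
Qed.

HB.instance Definition _ p X n :=
  isMeasurableFun.Build _ _ _ _ (erw_normalized p X n)
    (measurable_erw_normalized p X n).

(* [F] is the distribution function of the limit law. *)
Definition cvg_in_distribution (Y : nat -> {RV P >-> R}) (F : R -> \bar R) :
    Prop :=
  forall x : R, {for x, continuous F} -> cdf (Y n) x @[n --> \oo] --> F x.

End elephant.

Section limit_law.
Context (R : realType).

(* [normal_prob] takes the standard deviation; it is a normal law only when
   that is nonzero, so this is to be used with [0 < v]. *)
Definition normal_df (v : R) (x : R) : \bar R :=
  normal_prob 0 (Num.sqrt v) `]-oo, x].

Definition mixture_df (t : R) (F G : R -> \bar R) (x : R) : \bar R :=
  (t%:E * F x + (1 - t)%:E * G x)%E.

Definition sigmaT2 (p : R) : R :=
  1 + (2 * p - 1) * (5 - 5 * p - p ^+ 2) / (2 - p) ^+ 3.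

End limit_law.

(* Main.v *)
Require Import Defs.
From HB Require Import structures.
From mathcomp Require Import all_boot all_order all_algebra finmap ring lra.
From mathcomp Require Import all_classical all_reals all_analysis.

(** Given the first two steps [a], [b], the later steps form a two-state Markov
    chain with conditional mean [(2p-1)(a + b + X_n)/3], hence with stationary
    mean [drift] and limiting variance [avar]; averaging over the four values of
    [(a, b)] gives the mixture.

    The central limit theorem for the chain is proved by Trotter's method with
    test functions that are themselves normal distribution functions.
    [G0 v x = Phi (x / sqrt v)] solves the heat equation [dG0/dv = (1/2) d2G0/dx2],
    so along the walk the expectation of [G0 (v_k, y - M_k / sqrt n)], where [M_k]
    is the martingale part of the position and [v_k] decreases from [e + avar] to
    [e] in steps [avar / n], changes by [O(n^(-3/2))] at each step, once a
    corrector removes the dependence of the conditional variance on the last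
    step. Hence [E G0 (e, y - M_n / sqrt n)] tends to [G0 (e + avar, y)], and for
    small [e] the test function squeezes the indicator of [M_n / sqrt n <= y]. *)

Set Implicit Arguments.
Unset Strict Implicit.
Unset Printing Implicit Defensive.

Import Order.TTheory GRing.Theory Num.Theory.
Import numFieldNormedType.Exports.

Local Open Scope classical_set_scope.
Local Open Scope ring_scope.

(** * The normal distribution function *)

Section taylor.
Context {R : realType}.
Implicit Types (f g k l : R -> R) (a b u C : R).

Definition between a b u := (a <= u <= b) || (b <= u <= a).

Lemma between_sym a b u : between a b u = between b a u.
Proof. exact: orbC. Qed.

Lemma betweenl a b u w : between a b u -> between a u w -> between a b w.
Proof.
by rewrite /between => /orP[]/andP[? ?] /orP[]/andP[? ?]; apply/orP;
  [left|left|right|right]; apply/andP; split; lra.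
Qed.

Lemma between_dist a b u : between a b u -> `|u - a| <= `|b - a|.
Proof.
case/orP => /andP[? ?]; first by rewrite !ger0_norm; lra.
by rewrite !ler0_norm; lra.
Qed.

Lemma derive_bound f g a b C :
  (forall u, between a b u -> is_derive u 1 f (g u)) ->
  (forall u, between a b u -> `|g u| <= C) ->
  `|f b - f a| <= C * `|b - a|.
Proof.
wlog ab : a b / a <= b => [H|] df gC.
  have [ab|/ltW ba] := leP a b; first exact: H.
  rewrite distrC (distrC b); apply: H => // u; rewrite between_sym => h.
  - exact: df.
  - exact: gC.
have bE u : u \in `[a, b] -> between a b u.
  by rewrite in_itv/= /between => ->.
have [||x xab ->] := MVT_segment ab (f := f) (df := g).
- move=> x /subset_itv_oo_cc h; exact/df/bE.
- apply: derivable_within_continuous => x h.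
  exact: (@ex_derive _ _ _ _ _ _ _ (df _ (bE _ h))).
- by rewrite normrM ler_wpM2r// gC// bE.
Qed.

(** The mean value inequality is applied to [f u - u * g a], whose derivative [g u - g a] is bounded
    by the same inequality. Iterating it gives remainders with [C] instead of [C / 2] or [C / 6],
    which is enough here. *)
Lemma taylor1 f g k a b C :
  (forall u, between a b u -> is_derive u 1 f (g u)) ->
  (forall u, between a b u -> is_derive u 1 g (k u)) ->
  (forall u, between a b u -> `|k u| <= C) ->
  `|f b - f a - (b - a) * g a| <= C * `|b - a| ^+ 2.
Proof.
move=> df dg kC.
have -> : f b - f a - (b - a) * g a =
    (f b - b * g a) - (f a - a * g a) by ring.
rewrite expr2 mulrA.
apply: (@derive_bound (fun u => f u - u * g a) (fun u => g u - g a)) => u abu.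
  have := df _ abu => h; apply: is_derive_eq.
  by rewrite /GRing.scale/=; ring.
apply: (@le_trans _ _ (C * `|u - a|)).
  by apply: (@derive_bound _ k) => w auw;
    [apply: dg|apply: kC]; exact: betweenl auw.
rewrite ler_wpM2l ?between_dist//.
exact: le_trans (kC u abu).
Qed.

Lemma taylor2 f g k l a b C :
  (forall u, between a b u -> is_derive u 1 f (g u)) ->
  (forall u, between a b u -> is_derive u 1 g (k u)) ->
  (forall u, between a b u -> is_derive u 1 k (l u)) ->
  (forall u, between a b u -> `|l u| <= C) ->
  `|f b - f a - (b - a) * g a - (b - a) ^+ 2 / 2 * k a| <= C * `|b - a| ^+ 3.
Proof.
move=> df dg dk lC.
pose F u := f u - u * g a - (u - a) ^+ 2 / 2 * k a.
have -> : f b - f a - (b - a) * g a - (b - a) ^+ 2 / 2 * k a = F b - F a.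
  by rewrite /F; field.
rewrite exprS mulrCA mulrC.
apply: (@derive_bound F (fun u => g u - g a - (u - a) * k a)) => u abu.
  have := df _ abu => h; rewrite /F; apply: is_derive_eq.
  by rewrite /GRing.scale/=; field.
apply: (@le_trans _ _ (C * `|u - a| ^+ 2)).
  by apply: (@taylor1 _ _ l) => w auw;
    [apply: dg|apply: dk|apply: lC]; exact: betweenl auw.
rewrite ler_wpM2l ?lerXn2r ?nnegrE ?between_dist//.
exact: le_trans (lC u abu).
Qed.

End taylor.

(** * The Gaussian kernel, its derivatives and the heat equation *)

Section gauss.
Context {R : realType}.
Implicit Types v x y : R.

Definition std_pdf (z : R) : R := normal_peak 1 * expR (- z ^+ 2 / 2).

Lemma normal_pdf01E (z : R) : normal_pdf 0 1 z = std_pdf z.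
Proof.
by rewrite normal_pdfE ?oner_neq0// /std_pdf /normal_fun subr0 expr1n mulr2n.
Qed.

Definition Phi (x : R) : R := fine (normal_prob 0 1 `]-oo, x]).

Lemma PhiE x : (Phi x)%:E = normal_prob 0 1 `]-oo, x].
Proof. by rewrite fineK// fin_num_measure. Qed.

Lemma Phi_ge0 x : 0 <= Phi x.
Proof. by rewrite -lee_fin PhiE. Qed.

Lemma Phi_le1 x : Phi x <= 1.
Proof. by rewrite -lee_fin PhiE probability_le1. Qed.

Lemma Phi_nd x y : x <= y -> Phi x <= Phi y.
Proof.
move=> xy; rewrite -lee_fin !PhiE le_measure ?inE//.
exact: subset_itvl.
Qed.

(** Under the standard normal law the identity is a random variable whose [cdf] is [Phi], so the
    limits of distribution functions at infinity apply to [Phi]. *)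
Let idTR : measurableTypeR R -> R := idfun.

#[local] HB.instance Definition _ :=
  @isMeasurableFun.Build _ _ _ _ idTR (@measurable_id _ _ setT).

Lemma Phi_cvgy : Phi x @[x --> +oo] --> (1:R).
Proof.
have h := @cvg_cdfy1 _ _ R (normal_prob 0 1) (idTR : {RV (normal_prob (0:R) 1) >-> R}).
have -> : Phi = fine \o cdf (idTR : {RV (normal_prob (0:R) 1) >-> R}).
  by apply/funext => x.
exact: fine_cvg h.
Qed.

Lemma Phi_cvgNy : Phi x @[x --> -oo] --> (0:R).
Proof.
have h := @cvg_cdfNy0 _ _ R (normal_prob 0 1) (idTR : {RV (normal_prob (0:R) 1) >-> R}).
have -> : Phi = fine \o cdf (idTR : {RV (normal_prob (0:R) 1) >-> R}).
  by apply/funext => x.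
exact: fine_cvg h.
Qed.

(** Fundamental theorem of calculus on []-oo, x + 1]], where [x] is an interior point. *)
Global Instance is_derive_Phi x : is_derive x 1 Phi (std_pdf x).
Proof.
have intf : (lebesgue_measure.-integrable `]-oo, (x + 1)%R]
    (EFin \o normal_pdf (0:R) 1))%E.
  by apply: (integrableS _ _ (subsetT _)) => //; exact: integrable_normal_pdf.
have xx1 : x < x + 1 by rewrite ltrDl.
have [h1 h2] := continuous_FTC1 xx1 intf (ltNyr _)
  (@continuous_normal_pdf R 0 1 (oner_neq0 _) x).
by split; [exact: h1 | rewrite -normal_pdf01E -h2 derive1E].
Qed.

Global Instance is_derive_std_pdf x : is_derive x 1 std_pdf (- x * std_pdf x).
Proof.
rewrite /std_pdf; apply: is_derive_eq.
by rewrite /GRing.scale/=; field.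
Qed.

Definition rsqrt v : R := (Num.sqrt v)^-1.

Lemma rsqrt_gt0 v : 0 < v -> 0 < rsqrt v.
Proof. by move=> v0; rewrite invr_gt0 sqrtr_gt0. Qed.

Lemma is_derive_rsqrt v : 0 < v -> is_derive v 1 rsqrt (- (rsqrt v) ^+ 3 / 2).
Proof.
move=> v0; have s0 : Num.sqrt v != 0 by rewrite gt_eqF ?sqrtr_gt0.
have := is_derive1_sqrt v0 => h.
rewrite /rsqrt; apply: is_derive_eq.
rewrite /GRing.scale/=. by field.
Qed.


(** Standardization: the substitution [y * rsqrt v] has Jacobian [rsqrt v], which turns the peak of
    variance 1 into that of variance [v]. *)
Lemma normal_dfE v x : 0 < v -> normal_df v x = (Phi (x * rsqrt v))%:E.
Proof.
move=> v0; rewrite PhiE /normal_df /normal_prob.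
have r0 := rsqrt_gt0 v0.
pose F (y : R) : R := y * rsqrt v.
have dF (y : R) : is_derive y (1:R) F (rsqrt v).
  by rewrite /F; apply: is_derive_eq; rewrite /GRing.scale/=; ring.
have F'E : F^`()%classic = cst (rsqrt v).
  by apply/funext => y; rewrite derive1E derive_val.
rewrite -[x * rsqrt v]/(F x).
rewrite (@increasing_ge0_integration_by_substitutionNy _ F (normal_pdf 0 1) x).
- apply: eq_integral => y _; congr (_%:E).
  rewrite F'E !fctE/= normal_pdf01E normal_pdfE ?gt_eqF ?sqrtr_gt0//.
  rewrite /std_pdf /normal_fun /normal_peak /F /rsqrt.
  rewrite sqr_sqrtr ?(ltW v0)// subr0 expr1n mul1r -mulrnAr sqrtrM ?(ltW v0)//.
  rewrite invfM exprMn exprVn sqr_sqrtr ?(ltW v0)//.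
  have -> : - y ^+ 2 / (v *+ 2) = - (y ^+ 2 * v^-1) / 2.
    by rewrite -mulr_natr; field; rewrite gt_eqF.
  by ring.
- by move=> a b _ _ ab; rewrite ltr_pM2r.
- by rewrite F'E => ? _; exact: cvg_cst.
- by rewrite F'E; exact: is_cvg_cst.
- by rewrite F'E; exact: cvg_cst.
- split; first by move=> y _; exact: ex_derive.
  apply: cvg_at_left_filter; apply/differentiable_continuous.
  by apply/derivable1_diffP; exact: ex_derive.
- by apply/gt0_cvgMlNy => //; exact: cvg_id.
- by apply: continuous_subspaceT; apply: continuous_normal_pdf; exact: oner_neq0.
- by move=> y _; exact: normal_pdf_ge0.
Qed.

(* [Gi v] is the [i]-th derivative of the distribution function [G0 v] of the
   centred normal law of variance [v]. *)
Definition G0 v x := Phi (x * rsqrt v).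
Definition G1 v x := rsqrt v * std_pdf (x * rsqrt v).
Definition G2 v x := - (rsqrt v ^+ 2 * (x * rsqrt v) * std_pdf (x * rsqrt v)).
Definition G3 v x := rsqrt v ^+ 3 * ((x * rsqrt v) ^+ 2 - 1) * std_pdf (x * rsqrt v).
Definition G4 v x :=
  rsqrt v ^+ 4 * (3 * (x * rsqrt v) - (x * rsqrt v) ^+ 3) * std_pdf (x * rsqrt v).

Lemma G0_dx v x : is_derive x 1 (G0 v) (G1 v x).
Proof.
rewrite /G0 /G1; apply: is_derive_eq.
by rewrite /GRing.scale/=; ring.
Qed.

Lemma G1_dx v x : is_derive x 1 (G1 v) (G2 v x).
Proof.
rewrite /G1 /G2; apply: is_derive_eq.
by rewrite /std_pdf /GRing.scale/=; field.
Qed.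

Lemma G2_dx v x : is_derive x 1 (G2 v) (G3 v x).
Proof.
rewrite /G2 /G3; apply: is_derive_eq.
by rewrite /std_pdf /GRing.scale/=; field.
Qed.

Lemma G0_dv v x : 0 < v -> is_derive v 1 (G0 ^~ x) (G2 v x / 2).
Proof.
move=> v0; have := is_derive_rsqrt v0 => h.
rewrite /G0 /G2; apply: is_derive_eq.
by rewrite /std_pdf /GRing.scale/=; field.
Qed.

Lemma G2_dv v x : 0 < v -> is_derive v 1 (G2 ^~ x) (G4 v x / 2).
Proof.
move=> v0; have := is_derive_rsqrt v0 => h.
rewrite /G2 /G4; apply: is_derive_eq.
by rewrite /std_pdf /GRing.scale/=; field.
Qed.

Lemma G0_dvv v x : 0 < v -> is_derive v 1 (fun w => G2 w x / 2) (G4 v x / 2 / 2).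
Proof.
move=> v0; have := is_derive_rsqrt v0 => h.
rewrite /G2 /G4; apply: is_derive_eq.
by rewrite /std_pdf /GRing.scale/=; field.
Qed.

(** With [q = 1 + z^2 / 4], squaring [expR (z^2 / 4) >= q] gives [std_pdf z * q^2 <= normal_peak 1],
    and each polynomial factor below is at most [4 * q^2] in absolute value. *)
Lemma std_pdf_bounds : exists2 C : R, 0 <= C & forall z : R,
  [/\ `|std_pdf z| <= C, `|z * std_pdf z| <= C, `|(z ^+ 2 - 1) * std_pdf z| <= C &
      `|(3 * z - z ^+ 3) * std_pdf z| <= C].
Proof.
have c0 := @normal_peak_ge0 R 1.
exists (4 * normal_peak 1); first by rewrite mulr_ge0.
move=> z; pose q := 1 + z ^+ 2 / 4.
have q1 : 1 <= q by rewrite lerDl divr_ge0 ?sqr_ge0.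
have g0 : 0 <= std_pdf z by rewrite mulr_ge0 ?expR_ge0.
have gq : std_pdf z * q ^+ 2 <= normal_peak 1.
  rewrite /std_pdf -mulrA ler_piMr// mulNr expRN mulrC ler_pdivrMr ?expR_gt0// mul1r.
  have -> : z ^+ 2 / 2 = z ^+ 2 / 4 * 2%:R by field.
  rewrite expRM_natr lerXn2r ?nnegrE ?expR_ge0 ?(le_trans ler01)//.
  exact: expR_ge1Dx.
have key (w : R) : `|w| <= 4 * q ^+ 2 -> `|w * std_pdf z| <= 4 * normal_peak 1.
  move=> wq; rewrite normrM (ger0_norm g0).
  apply: (@le_trans _ _ (4 * q ^+ 2 * std_pdf z)); first by rewrite ler_wpM2r.
  by rewrite -mulrA ler_wpM2l// mulrC.
have qq : q <= q ^+ 2 by rewrite expr2 ler_peMr// (le_trans ler01).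
have zq : `|z| <= q.
  by rewrite ler_norml; apply/andP; split; rewrite /q;
    [have := sqr_ge0 (1 + z / 2)|have := sqr_ge0 (1 - z / 2)]; lra.
have z2q : z ^+ 2 = 4 * q - 4 by rewrite /q; field.
split.
- by rewrite -[std_pdf z]mul1r; apply: key; rewrite normr1; nra.
- by apply: key; rewrite (le_trans zq)//; nra.
- by apply: key; rewrite z2q ler_norml; apply/andP; split; nra.
- apply: key; have -> : 3 * z - z ^+ 3 = z * (3 - z ^+ 2) by ring.
  rewrite normrM mulrC; have : `|3 - z ^+ 2| <= 4 * q.
    by rewrite z2q ler_norml; apply/andP; split; lra.
  move=> h; rewrite expr2 mulrA; exact: ler_pM.
Qed.

Lemma G_bounds a : 0 < a -> exists2 C : R, 0 <= C & forall v x, a <= v ->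
  [/\ `|G1 v x| <= C, `|G2 v x| <= C, `|G3 v x| <= C & `|G4 v x| <= C].
Proof.
move=> a0; have [C C0 gC] := std_pdf_bounds.
(* Since [M >= 1], the single power [M ^+ 4] dominates every [rsqrt v ^+ n] with [n <= 4] and
   [v >= a]. *)
pose M := 1 + rsqrt a.
have ra0 := rsqrt_gt0 a0.
have M0 : 0 <= M by rewrite addr_ge0// ltW.
have M1 : 1 <= M by rewrite lerDl ltW.
exists (M ^+ 4 * C); first by rewrite mulr_ge0 ?exprn_ge0.
move=> v x av; have v0 : 0 < v by exact: lt_le_trans av.
have r0 := rsqrt_gt0 v0.
have rM : rsqrt v <= M.
  apply: (@le_trans _ _ (rsqrt a)); last by rewrite lerDr.
  by rewrite /rsqrt lef_pV2 ?posrE ?sqrtr_gt0//; exact: ler_wsqrtr.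
have key n w : (n <= 4)%N -> `|w| <= C -> `|rsqrt v ^+ n * w| <= M ^+ 4 * C.
  move=> n4 wC; rewrite normrM ler_pM// normrX ger0_norm ?(ltW r0)//.
  apply: (@le_trans _ _ (M ^+ n)); last exact: ler_weXn2l.
  by rewrite lerXn2r ?nnegrE ?(ltW r0).
have [g1 g2 g3 g4] := gC (x * rsqrt v).
split.
- by rewrite /G1 -[X in X * std_pdf _]expr1; exact: key.
- by rewrite /G2 normrN -mulrA; exact: key.
- by rewrite /G3 -mulrA; exact: key.
- by rewrite /G4 -mulrA; exact: key.
Qed.

Let dist_trans (p q r e1 e2 : R) :
  `|p - q| <= e1 -> `|q - r| <= e2 -> `|p - r| <= e1 + e2.
Proof. by move=> h1 h2; rewrite (le_trans (ler_distD q _ _))// lerD. Qed.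

(** The variance is changed first, at the new point, where the heat equation gives slope [t1 / 2];
    then [t1] is replaced by its value [t0] at the old point; last comes the second-order expansion
    in space. *)
Let heat_split (p q r s t0 t1 d h e1 e2 e3 : R) :
  `|p - q - h * (t1 / 2)| <= e1 -> `|h / 2 * (t1 - t0)| <= e2 ->
  `|q - r - d * s - d ^+ 2 / 2 * t0| <= e3 ->
  `|p - r - d * s - (d ^+ 2 + h) / 2 * t0| <= e1 + e2 + e3.
Proof.
move=> h1 h2 h3.
have -> : p - r - d * s - (d ^+ 2 + h) / 2 * t0 =
  (p - q - h * (t1 / 2)) + h / 2 * (t1 - t0) +
  (q - r - d * s - d ^+ 2 / 2 * t0) by field.
by rewrite (le_trans (ler_normD _ _))// lerD// (le_trans (ler_normD _ _))// lerD.
Qed.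

(** In the last estimate the heat equation merges the variance increment with the square of the
    space increment: a random increment of mean zero and second moment [v - w] leaves only the
    remainder on average. *)
Lemma G_lipschitz a : 0 < a -> exists2 C : R, 0 <= C &
  [/\ forall v x, a <= v -> `|G2 v x| <= C,
      forall v w x y, a <= v -> a <= w ->
        `|G0 w y - G0 v x| <= C * (`|w - v| + `|y - x|),
      forall v w x y, a <= v -> a <= w ->
        `|G2 w y - G2 v x| <= C * (`|w - v| + `|y - x|) &
      forall v w x y, a <= v -> a <= w ->
        `|G0 w y - G0 v x - (y - x) * G1 v x
          - ((y - x) ^+ 2 + (w - v)) / 2 * G2 v x| <=
        C * (`|w - v| ^+ 2 + `|w - v| * `|y - x| + `|y - x| ^+ 3)].
Proof.
move=> a0; have [C C0 GC] := G_bounds a0; exists C => //.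
have bE (v w u : R) : a <= v -> a <= w -> between v w u -> 0 < u /\ a <= u.
  by move=> ? ? /orP[]/andP[? ?]; split; lra.
have G0x v x y : a <= v -> `|G0 v y - G0 v x| <= C * `|y - x|.
  move=> av; apply: (@derive_bound _ _ (G1 v)) => u _; first exact: G0_dx.
  by have [] := GC v u av.
have G2x v x y : a <= v -> `|G2 v y - G2 v x| <= C * `|y - x|.
  move=> av; apply: (@derive_bound _ _ (G3 v)) => u _; first exact: G2_dx.
  by have [] := GC v u av.
have n2 : `|2^-1 : R| = 2^-1 by rewrite ger0_norm.
have half (r : R) : `|r| <= C -> `|r / 2| <= C.
  by move=> rC; rewrite normrM n2; have := normr_ge0 r; lra.
have G0v v w x : a <= v -> a <= w -> `|G0 w x - G0 v x| <= C * `|w - v|.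
  move=> av aw; apply: (@derive_bound _ (G0 ^~ x) (fun v => G2 v x / 2)).
    by move=> u /(bE _ _ _ av aw)[u0 _]; exact: G0_dv.
  by move=> u /(bE _ _ _ av aw)[_ au]; apply: half; have [] := GC u x au.
have G2v v w x : a <= v -> a <= w -> `|G2 w x - G2 v x| <= C * `|w - v|.
  move=> av aw; apply: (@derive_bound _ (G2 ^~ x) (fun v => G4 v x / 2)).
    by move=> u /(bE _ _ _ av aw)[u0 _]; exact: G2_dv.
  by move=> u /(bE _ _ _ av aw)[_ au]; apply: half; have [] := GC u x au.
split.
- by move=> v x av; have [] := GC v x av.
- move=> v w x y av aw.
  by rewrite mulrDr; exact: dist_trans (G0v _ _ _ av aw) (G0x _ _ _ av).
- move=> v w x y av aw.
  by rewrite mulrDr; exact: dist_trans (G2v _ _ _ av aw) (G2x _ _ _ av).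
- move=> v w x y av aw.
  have h1 : `|G0 w y - G0 v y - (w - v) * (G2 v y / 2)| <= C * `|w - v| ^+ 2.
    apply: (@taylor1 _ (G0 ^~ y) (fun v => G2 v y / 2) (fun v => G4 v y / 2 / 2)).
    - by move=> u /(bE _ _ _ av aw)[u0 _]; exact: G0_dv.
    - by move=> u /(bE _ _ _ av aw)[u0 _]; exact: G0_dvv.
    - by move=> u /(bE _ _ _ av aw)[_ au]; have [_ _ _ ?] := GC u y au; exact/half/half.
  have h2 : `|(w - v) / 2 * (G2 v y - G2 v x)| <= C * (`|w - v| * `|y - x|).
    rewrite normrM mulrCA; apply: ler_pM => //; last exact: G2x.
    by rewrite normrM n2; have := normr_ge0 (w - v); lra.
  have h3 : `|G0 v y - G0 v x - (y - x) * G1 v x - (y - x) ^+ 2 / 2 * G2 v x| <=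
      C * `|y - x| ^+ 3.
    apply: (@taylor2 _ _ (G1 v) (G2 v) (G3 v)) => u _.
    - exact: G0_dx.
    - exact: G1_dx.
    - exact: G2_dx.
    - by have [] := GC v u av.
  apply: (le_trans (heat_split h1 h2 h3)).
  by rewrite -!mulrDr.
Qed.

Lemma Phi_tail e : 0 < e -> exists2 M, 0 < M & 1 - e <= Phi M /\ Phi (- M) <= e.
Proof.
move=> e0.
have [M1 [_ h1]] : \forall x \near +oo, 1 - e < Phi x.
  by apply: (cvgr_gt (1:R) Phi_cvgy); rewrite ltrBlDr ltrDl.
have [M2 [_ h2]] : \forall x \near -oo, Phi x < e.
  exact: (cvgr_lt (0:R) Phi_cvgNy).
exists (1 + `|M1| + `|M2|); first by rewrite -addrA ltr_pwDl// addr_ge0.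
split; apply: ltW.
- by apply: h1; have := ler_norm M1; have := normr_ge0 M2; lra.
- apply: h2; have := ler_norm (- M2); rewrite normrN.
  by have := normr_ge0 M1; lra.
Qed.

End gauss.

(** * The law of the walk given its first two steps *)

Section conditional_law.
Context {R : realType} (p : R).
Hypothesis p01 : 0 < p < 1.
Implicit Types (a b x z s : R) (f g : R -> R -> R).

Definition is_sign x := (x == 1) || (x == -1).

Lemma is_signN x : is_sign x -> is_sign (- x).
Proof. by rewrite /is_sign !eqr_oppLR opprK orbC. Qed.

Lemma is_sign_norm x : is_sign x -> `|x| = 1.
Proof. by case/orP => /eqP ->; rewrite ?normrN normr1. Qed.

(* Conditional expectation of [f] at the next step and position, when [s] is the
   current position and [l] lists the remembered steps. *)
Definition remember (l : seq R) f s : R :=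
  (size l)%:R^-1 * \sum_(z <- l) (p * f z (s + z) + (1 - p) * f (- z) (s - z)).

(* Conditional expectation of [f] at [X_(j+2)] and [S_(j+2)], given the first two
   steps [a] and [b]. *)
Fixpoint law a b j f : R :=
  match j with
  | 0%N => f b (a + b)
  | j'.+1 => law a b j'
      (fun x s => remember (if j' is 0%N then [:: a; b] else [:: a; b; x]) f s)
  end.

Lemma remember_le (l : seq R) f g s e : (0 < size l)%N ->
  (forall z, z \in l -> f z (s + z) <= g z (s + z) + e /\
                        f (- z) (s - z) <= g (- z) (s - z) + e) ->
  remember l f s <= remember l g s + e.
Proof.
move=> l0 fg; have n0 : (0 : R) < (size l)%:R by rewrite ltr0n.
have -> : e = (size l)%:R^-1 * \sum_(z <- l) e.
  rewrite big_const_seq count_predT iter_addr_0 -[X in _ * X]mulr_natl.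
  rewrite mulrA mulVf ?mul1r//.
  by rewrite gt_eqF.
rewrite /remember -mulrDr ler_pM2l ?invr_gt0// -big_split/=.
rewrite !big_seq; apply: ler_sum => z zl; have [h1 h2] := fg z zl.
by case/andP: p01 => p0 p1; nra.
Qed.

(** Averaging preserves inequalities, and only reachable states count: the last step is a sign and
    the position is at most the number of steps, [j.+2]. The latter bound controls the walk at time
    3 in [law_heat_flow]. *)
Lemma law_le a b j f g e : is_sign a -> is_sign b ->
  (forall x s, is_sign x -> `|s| <= j.+2%:R -> f x s <= g x s + e) ->
  law a b j f <= law a b j g + e.
Proof.
move=> sa sb; elim: j f g => [|j IH] f g fg /=.
  apply: fg => //; rewrite (le_trans (ler_normD _ _))// !is_sign_norm//.
apply: IH => x s sx sj; apply: remember_le; first by case: (j).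
move=> z zl; have sz : is_sign z.
  by case: (j) zl => [|?]; rewrite !inE; [case/orP|case/or3P] => /eqP ->.
have js : `|s| + 1 <= j.+3%:R by rewrite -[leRHS]natr1 lerD2r.
split; apply: fg => //; rewrite ?is_signN//.
- by rewrite (le_trans (ler_normD _ _))// (is_sign_norm sz).
- by rewrite (le_trans (ler_normB _ _))// (is_sign_norm sz).
Qed.

Lemma law_dist a b j f g e : is_sign a -> is_sign b ->
  (forall x s, is_sign x -> `|s| <= j.+2%:R -> `|f x s - g x s| <= e) ->
  `|law a b j f - law a b j g| <= e.
Proof.
move=> sa sb fg; rewrite ler_distl; apply/andP; split.
- rewrite lerBlDr; apply: law_le => // x s sx sj.
  by have := fg x s sx sj; rewrite ler_distl => /andP[]; rewrite lerBlDr.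
- by apply: law_le => // x s sx sj; have := fg x s sx sj; rewrite ler_distl => /andP[].
Qed.

Lemma law_cst a b j (c : R) : law a b j (fun _ _ => c) = c.
Proof.
elim: j => //= j IH.
rewrite -[RHS]IH; congr law; apply/funext => x; apply/funext => s.
rewrite /remember big_const_seq count_predT iter_addr_0 -[X in _ * X]mulr_natl.
rewrite mulrA mulVf.
  by rewrite mul1r; ring.
by rewrite pnatr_eq0; case: (j).
Qed.

End conditional_law.

(** * Martingale decomposition and heat flow along the conditional chain *)

Section martingale_clt.
Context {R : realType} (p a b : R).
Hypotheses (p01 : 0 < p < 1) (sa : is_sign a) (sb : is_sign b).

Let p0 : 0 < p. Proof. by case/andP: p01. Qed.
Let p1 : p < 1. Proof. by case/andP: p01. Qed.
Let p2 : 2 - p != 0. Proof. by have h := p1; rewrite gt_eqF//; lra. Qed.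
Let p4 : 4 - 2 * p != 0. Proof. by have h := p1; rewrite gt_eqF//; lra. Qed.

(** Put [lam = (2 * p - 1) / 3], the factor by which the conditional mean of the centred step
    contracts. In [avar], [1 - drift ^+ 2] is the variance of a sign of mean [drift], and
    [(1 + p) / (2 - p)] is [(1 + lam) / (1 - lam)], the effect of the correlations. *)
Definition drift : R := (2 * p - 1) * ((a + b) / 2) / (2 - p).
Definition avar : R := (1 - drift ^+ 2) * ((1 + p) / (2 - p)).

(** [gam = lam / (1 - lam)] solves the Poisson equation of the chain. *)
Let gam : R := (2 * p - 1) / (4 - 2 * p).
(** Given last step [x], the variance of the martingale increment is
    [avar - 2 * gam * drift * (x - drift)]. Half of the excess is absorbed when
    [kap * (1 - lam) = - gam * drift]. *)
Let kap : R := - (gam * drift * (3 / (4 - 2 * p))).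

(** * Telescoping for any family of functions with the heat-flow estimates *)

Section heat.
Variables (g0 g1 g2 : R -> R -> R) (e C : R).
Hypothesis C0 : 0 <= C.
Hypothesis g2b : forall v x, e <= v -> `|g2 v x| <= C.
Hypothesis g0l : forall v w x y, e <= v -> e <= w ->
  `|g0 w y - g0 v x| <= C * (`|w - v| + `|y - x|).
Hypothesis g2l : forall v w x y, e <= v -> e <= w ->
  `|g2 w y - g2 v x| <= C * (`|w - v| + `|y - x|).
Hypothesis g0t : forall v w x y, e <= v -> e <= w ->
  `|g0 w y - g0 v x - (y - x) * g1 v x - ((y - x) ^+ 2 + (w - v)) / 2 * g2 v x|
  <= C * (`|w - v| ^+ 2 + `|w - v| * `|y - x| + `|y - x| ^+ 3).

(* [S_n - n * drift + gam * (X_n - drift)] is a martingale, of which [o] collects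
   the constant part; the [kap] term cancels the dependence on [X_n] of its
   conditional variance. *)
Definition corrected (y c v o x s : R) : R :=
  g0 v (y - c * (s - o + gam * x)) +
  kap * c ^+ 2 * (x - drift) * g2 v (y - c * (s - o + gam * x)).

(** One crude constant, at least 1, that dominates all coefficients of the error terms. *)
Let K : R := 1 + `|avar| + (`|kap| + `|gam| + 1) * (1 + `|drift|) + 2 * `|gam|.

Let K_ge (z x : R) : is_sign z -> is_sign x ->
  [/\ `|avar| <= K, 1 + `|drift| <= K, `|kap * (z - drift)| <= K,
      `|gam * (z - drift)| <= K & `|z - drift + gam * (z - x)| <= K].
Proof.
move=> sz sx.
have zd : `|z - drift| <= 1 + `|drift|.
  by rewrite (le_trans (ler_normB _ _))// (is_sign_norm sz).
have zx : `|z - x| <= 2.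
  by rewrite (le_trans (ler_normB _ _))// (is_sign_norm sz) (is_sign_norm sx).
have h (u : R) : `|u * (z - drift)| <= `|u| * (1 + `|drift|).
  by rewrite normrM ler_wpM2l.
have hx : `|gam * (z - x)| <= 2 * `|gam| by rewrite normrM mulrC ler_wpM2r.
have hd := ler_normD (z - drift) (gam * (z - x)).
have hk := h kap; have hg := h gam; rewrite /K.
move: (normr_ge0 avar) (normr_ge0 kap) (normr_ge0 gam) (normr_ge0 drift).
move: zd hk hg hx hd.
move: (`|z - drift + _|) (`|kap * _|) (`|gam * (z - drift)|) (`|gam * (z - x)|).
move: (`|z - drift|) (`|avar|) (`|kap|) (`|gam|) (`|drift|) => *.
by split; nra.
Qed.

(* Second-order expansion of [corrected] at the next step, when that step is
   [z]. *)
Let approx (y c v o x s : R) (z : R) : R :=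
  let u := y - c * (s - o + gam * x) in
  let d := - c * (z - drift + gam * (z - x)) in
  g0 v u + d * g1 v u + (d ^+ 2 - avar * c ^+ 2) / 2 * g2 v u +
  kap * c ^+ 2 * (z - drift) * g2 v u.

(** An exact identity: [gam] makes the [g1] term average to zero, [avar] cancels the constant part
    of the [g2] term and [kap] the part depending on [x]. It is checked on the eight sign patterns
    of [a], [b], [x]. *)
Lemma approx_mean y c v o x s : is_sign x ->
  remember p [:: a; b; x] (fun z _ => approx y c v o x s z) s =
  corrected y c v o x s.
Proof.
move=> sx; rewrite /remember !big_cons big_nil /corrected /approx /=.
set u := y - _; move: (g0 v u) (g1 v u) (g2 v u) => G0 G1 G2.
rewrite /kap /avar /gam /drift.
by move: sa sb sx => /orP[]/eqP-> /orP[]/eqP-> /orP[]/eqP->; field; rewrite p2 p4.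
Qed.

(** This amounts to [|drift| < 1]: [|a + b| <= 2], and [|2 * p - 1| < 2 - p] for [0 < p < 1]. *)
Lemma avar_gt0 : 0 < avar.
Proof.
have h0 := p0; have h1 := p1.
have p2_gt0 : 0 < 2 - p by lra.
have -> : avar = (4 * (2 - p) ^+ 2 - (2 * p - 1) ^+ 2 * (a + b) ^+ 2)
    * (1 + p) / (4 * (2 - p) ^+ 3).
  by rewrite /avar /drift; field.
rewrite divr_gt0 ?mulr_gt0 ?exprn_gt0//; last by lra.
by move: sa sb => /orP[]/eqP-> /orP[]/eqP->; nra.
Qed.

(** The space increment is [O(c)] and the variance increment [O(c^2)]. Each of the three terms of
    the Taylor remainder is at most [(K * c)^3]; the variation of [g2] in the corrector adds
    [2 * K^2 * c^3], rounded up to [2 * K^3 * c^3]. *)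
Lemma corrected_step_dist y c v o x z s : is_sign x -> is_sign z ->
  0 <= c <= 1 -> e <= v - avar * c ^+ 2 ->
  `|corrected y c (v - avar * c ^+ 2) (o + drift) z (s + z)
    - approx y c v o x s z| <= 5 * C * K ^+ 3 * c ^+ 3.
Proof.
move=> sx sz /andP[c0 c1] ev.
have [Kav Kdr Kk _ Kd] := K_ge sz sx.
have K1 : 1 <= K by rewrite (le_trans _ Kdr)// lerDl.
have av0 := ltW avar_gt0.
have ev' : e <= v by rewrite (le_trans ev)// lerBlDr lerDl mulr_ge0 ?sqr_ge0.
rewrite /corrected /approx /=.
set u := y - c * (s - o + gam * x).
set u' := y - _; set d := - c * _; set w := v - _.
have ud : u' = u + d by rewrite /u' /u /d; ring.
have wv : w - v = - (avar * c ^+ 2) by rewrite /w; ring.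
have := g0t u u' ev' ev; have := g2l u u' ev' ev.
have -> : u' - u = d by rewrite ud; ring.
rewrite wv normrN.
have hd : `|d| <= K * c.
  by rewrite /d mulNr normrN normrM ger0_norm// mulrC ler_wpM2r.
have hw : `|avar * c ^+ 2| <= K * c ^+ 2.
  by rewrite normrM [X in _ * X]ger0_norm ?sqr_ge0// ler_wpM2r ?sqr_ge0.
move: (g0 w u') (g0 v u) (g2 w u') (g2 v u) (g1 v u) => A B A2 B2 B1 h2 h0.
have -> : A + kap * c ^+ 2 * (z - drift) * A2 -
  (B + d * B1 + (d ^+ 2 - avar * c ^+ 2) / 2 * B2 +
   kap * c ^+ 2 * (z - drift) * B2) =
  (A - B - d * B1 - (d ^+ 2 + - (avar * c ^+ 2)) / 2 * B2) +
  (kap * (z - drift)) * (c ^+ 2 * (A2 - B2)) by ring.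
apply: (le_trans (ler_normD _ _)).
rewrite [X in _ + X]normrM (normrM (c ^+ 2)) (ger0_norm (sqr_ge0 c)).
have {}h2 : `|A2 - B2| <= C * (2 * K * c).
  apply: (le_trans h2); rewrite ler_wpM2l//.
  have : K * c ^+ 2 <= K * c by rewrite ler_wpM2l ?expr2 ?ler_piMr//; lra.
  by move: hd hw; move: (`|d|) (`|_ * _|) => D W *; lra.
have {}h0 : `|A - B - d * B1 - (d ^+ 2 + - (avar * c ^+ 2)) / 2 * B2| <=
    C * (3 * K ^+ 3 * c ^+ 3).
  apply: (le_trans h0); rewrite ler_wpM2l//.
  move: hd hw; move: (`|d|) (normr_ge0 d) (`|_ * _|) (normr_ge0 (avar * c ^+ 2)).
  move=> D D0 W W0 DK WK.
  have ct : c <= K * c by rewrite ler_peMl.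
  have -> : 3 * K ^+ 3 * c ^+ 3 = (K * c) ^+ 3 *+ 3 by rewrite -mulr_natr; ring.
  have Wt : W <= (K * c) ^+ 2.
    by apply: (le_trans WK); rewrite exprMn ler_wpM2r ?sqr_ge0// expr2 ler_peMr//; lra.
  have Wt' : W <= K * c by apply: (le_trans WK); rewrite expr2 mulrA ler_piMr//; lra.
  have h1 : W ^+ 2 <= (K * c) ^+ 3 by rewrite exprS expr1 [leRHS]exprS ler_pM.
  have h3 : W * D <= (K * c) ^+ 3 by rewrite [leRHS]exprSr ler_pM.
  have h4 : D ^+ 3 <= (K * c) ^+ 3 by rewrite lerXn2r ?nnegrE//; lra.
  by rewrite !mulrS mulr0n; lra.
apply: (@le_trans _ _ (C * (3 * K ^+ 3 * c ^+ 3) + K * (c ^+ 2 * (C * (2 * K * c))))).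
  rewrite lerD// ler_pM// ?mulr_ge0 ?sqr_ge0//; last by rewrite ler_wpM2l ?sqr_ge0.
have -> : 5 * C * K ^+ 3 * c ^+ 3 =
  C * (3 * K ^+ 3 * c ^+ 3) + K * (c ^+ 2 * (C * (2 * K * c))) +
  2 * C * c ^+ 3 * (K - 1) * K ^+ 2 by ring.
rewrite lerDl !mulr_ge0 ?sqr_ge0 ?subr_ge0 ?exprn_ge0//; lra.
Qed.

Lemma corrected_step y c v o x s : is_sign x ->
  0 <= c <= 1 -> e <= v - avar * c ^+ 2 ->
  `|remember p [:: a; b; x] (corrected y c (v - avar * c ^+ 2) (o + drift)) s
    - corrected y c v o x s| <= 5 * C * K ^+ 3 * c ^+ 3.
Proof.
move=> sx c01 ev; rewrite -(approx_mean y c v o s sx).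
have sz z : z \in [:: a; b; x] -> is_sign z.
  by rewrite !inE => /or3P[]/eqP->.
have h z : is_sign z -> _ := fun sz => @corrected_step_dist y c v o x z _ sx sz c01 ev.
rewrite ler_distl; apply/andP; split.
- rewrite lerBlDr; apply: remember_le => // z zl; have zs := sz z zl.
  have zs' := is_signN zs.
  split.
  + by have := h s _ zs; rewrite ler_distl lerBlDr => /andP[].
  + by have := h s _ zs'; rewrite ler_distl lerBlDr => /andP[].
- apply: remember_le => // z zl; have zs := sz z zl.
  have zs' := is_signN zs.
  split.
  + by have := h s _ zs; rewrite ler_distl => /andP[].
  + by have := h s _ zs'; rewrite ler_distl => /andP[].
Qed.

(** The last step is peeled off, which raises the variance argument by [avar * c ^+ 2]; hence the
    induction for all [v]. The telescoping stops at [law p a b 1] because the transition before it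
    remembers two steps only, so [corrected_step] does not cover it. *)
Lemma law_corrected y c v o j : 0 <= c <= 1 -> e <= v ->
  `|law p a b j.+1 (corrected y c v (o + j%:R * drift))
    - law p a b 1 (corrected y c (v + j%:R * (avar * c ^+ 2)) o)| <=
  j%:R * (5 * C * K ^+ 3 * c ^+ 3).
Proof.
move=> c01; elim: j v => [|j IH] v ev.
  by rewrite !mul0r !addr0 subrr normr0.
have av0 := ltW avar_gt0.
have ev' : e <= v + avar * c ^+ 2 by rewrite (le_trans ev)// lerDl mulr_ge0 ?sqr_ge0.
have := IH _ ev'.
have -> : v + avar * c ^+ 2 + j%:R * (avar * c ^+ 2) =
  v + j.+1%:R * (avar * c ^+ 2) by rewrite -natr1; ring.
move=> h; rewrite -natr1 [leRHS]mulrDl mul1r [leRHS]addrC.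
apply: (le_trans (ler_distD
  (law p a b j.+1 (corrected y c (v + avar * c ^+ 2) (o + j%:R * drift))) _ _)).
rewrite lerD//; last by rewrite natr1.
rewrite -[law p a b j.+2 _]/(law p a b j.+1 _).
apply: law_dist => // x s sx _.
have := @corrected_step y c (v + avar * c ^+ 2) (o + j%:R * drift) x s sx c01.
rewrite addrK.
have -> : o + j%:R * drift + drift = o + (j%:R + 1) * drift by ring.
by apply.
Qed.

Lemma corrected_close y c v o w u x s : is_sign x -> 0 <= c <= 1 ->
  e <= v -> e <= w ->
  `|corrected y c v o x s - g0 w u| <=
    C * (`|v - w| + `|y - c * (s - o + gam * x) - u|) + C * K * c.
Proof.
move=> sx /andP[c0 c1] ev ew.
have [_ _ Kk _ _] := K_ge sx sx.
rewrite /corrected addrAC (le_trans (ler_normD _ _))// lerD ?g0l//.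
have -> : kap * c ^+ 2 * (x - drift) = kap * (x - drift) * c ^+ 2 by ring.
have K0 : 0 <= K by exact: le_trans Kk.
rewrite normrM (_ : C * K * c = K * c * C); last by ring.
apply: ler_pM => //; last exact: g2b.
rewrite normrM ler_pM// ger0_norm ?sqr_ge0//.
by rewrite expr2 ler_piMr.
Qed.

Lemma law_heat_flow y j (c := (Num.sqrt j.+3%:R)^-1) :
  `|law p a b j.+1 (fun _ s => g0 e (y - c * (s - j.+3%:R * drift)))
    - g0 (e + avar) y| <= (10 * C * K + 5 * C * K ^+ 3) * c.
Proof.
have n0 : (0 : R) < j.+3%:R by rewrite ltr0n.
have c0 : 0 <= c by rewrite invr_ge0 sqrtr_ge0.
have c1 : c <= 1.
  by rewrite invf_le1 ?sqrtr_gt0// -[leLHS]sqrtr1 ler_wsqrtr// ler1n.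
have nc2 : j.+3%:R * c ^+ 2 = 1.
  by rewrite exprVn sqr_sqrtr ?ler0n// divff// gt_eqF.
have c01 : 0 <= c <= 1 by rewrite c0 c1.
have [Kav Kdr _ _ _] := K_ge sa sa.
have av0 := avar_gt0.
move: Kav; rewrite gtr0_norm// => Kav.
have K1 : 1 <= K by rewrite (le_trans _ Kdr)// lerDl.
(* The offset at time 3: then [s - o + gam * x] is [s - 3 * drift + gam * (x - drift)]. *)
pose o : R := 3 * drift + gam * drift.
have jE : (j%:R : R) = j.+3%:R - 3 by rewrite -addn3 natrD addrK.
have h1 : `|law p a b j.+1 (fun _ s => g0 e (y - c * (s - j.+3%:R * drift)))
    - law p a b j.+1 (corrected y c e (o + j%:R * drift))| <= 2 * C * K * c.
  apply: law_dist => // x s sx _; rewrite distrC.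
  apply: (le_trans (corrected_close _ _ _ _ sx c01 _ _)) => //.
  rewrite subrr normr0 add0r.
  have -> : y - c * (s - (o + j%:R * drift) + gam * x) -
    (y - c * (s - j.+3%:R * drift)) = - (c * (gam * (x - drift))).
    by rewrite jE /o; ring.
  rewrite normrN normrM (ger0_norm c0).
  have [_ _ _ Kg _] := K_ge sx sx.
  have : C * (c * `|gam * (x - drift)|) <= C * (c * K) by rewrite !ler_wpM2l.
  lra.
(* With [c ^+ 2 = 1 / j.+3], the sum of [j] errors of order [c ^+ 3] is of order [c]. *)
have h2 : j%:R * (5 * C * K ^+ 3 * c ^+ 3) <= 5 * C * K ^+ 3 * c.
  have -> : j%:R * (5 * C * K ^+ 3 * c ^+ 3) = (j%:R * c ^+ 2) * (5 * C * K ^+ 3 * c).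
    by ring.
  have hj : j%:R * c ^+ 2 <= 1.
    by rewrite -[leRHS]nc2 ler_wpM2r ?sqr_ge0// ler_nat -addn3 leq_addr.
  by rewrite ler_piMl ?mulr_ge0 ?exprn_ge0//; lra.
(* Only [j] of the [j.+3] steps are run, so the variance misses [3 * avar * c ^+ 2], and the
   position at time 3 is bounded. The factor 8 is 3 for the variance, 4 for the position and 1 for
   the corrector. *)
have h3 : `|law p a b 1 (corrected y c (e + j%:R * (avar * c ^+ 2)) o)
    - g0 (e + avar) y| <= 8 * C * K * c.
  rewrite -[g0 _ _](law_cst p a b 1); apply: law_dist => // x s sx s3.
  apply: (le_trans (corrected_close _ _ _ _ sx c01 _ _)) => //.
  - by rewrite lerDl mulr_ge0 ?ler0n// mulr_ge0 ?sqr_ge0 ?(ltW av0).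
  - by rewrite lerDl ltW.
  have -> : e + j%:R * (avar * c ^+ 2) - (e + avar) = - (3 * avar * c ^+ 2).
    rewrite jE.
    transitivity (avar * (j.+3%:R * c ^+ 2 - 1) - 3 * avar * c ^+ 2); first by ring.
    by rewrite nc2; ring.
  have -> : y - c * (s - o + gam * x) - y =
    - (c * (s - 3 * drift + gam * (x - drift))) by rewrite /o; ring.
  rewrite !normrN (normrM c) (ger0_norm c0).
  have [_ _ _ Kg _] := K_ge sx sx.
  have hs : `|s - 3 * drift + gam * (x - drift)| <= 4 * K.
    rewrite (le_trans (ler_normD _ _))//.
    have := ler_normB s (3 * drift); rewrite normrM (ger0_norm (ler0n _ 3)).
    by lra.
  have hv : `|3 * avar * c ^+ 2| <= 3 * K * c.
    rewrite ger0_norm; last by rewrite mulr_ge0 ?sqr_ge0// mulr_ge0 ?(ltW av0).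
    have : c ^+ 2 <= c by rewrite expr2 ler_piMr.
    by nra.
  have : C * (`|3 * avar * c ^+ 2| + c * `|s - 3 * drift + gam * (x - drift)|)
    <= C * (3 * K * c + c * (4 * K)).
    by apply: ler_wpM2l => //; apply: lerD => //; exact: ler_wpM2l.
  lra.
have h := @law_corrected y c e o j c01 (lexx _).
apply: (le_trans (ler_distD _ _ _)).
apply: (le_trans (lerD h1 (ler_distD _ _ _))).
apply: (le_trans (lerD (lexx _) (lerD h h3))).
lra.
Qed.

End heat.
End martingale_clt.

(** * From smooth test functions to the distribution function *)

Section normal_limit.
Context {R : realType} (p a b : R).
Hypotheses (p01 : 0 < p < 1) (sa : is_sign a) (sb : is_sign b).
Local Notation drift := (drift p a b).
Local Notation avar := (avar p a b).

Lemma law_cvg_normal y :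
  law p a b j.+1 (fun _ s =>
    ((s - j.+3%:R * drift) / Num.sqrt j.+3%:R <= y)%R%:R) @[j --> \oo] -->
  Phi (y * rsqrt avar).
Proof.
apply/cvgrPdist_le => eps eps0.
have e30 : 0 < eps / 3 by rewrite divr_gt0.
have [M M0 [PhiM PhiNM]] := Phi_tail e30.
have [C C0 [_ Glip _ _]] := G_lipschitz (avar_gt0 p01 sa sb).
(* [del] is the standard deviation of the smoothing. It depends on [C], a Lipschitz constant for
   variances at least [avar], so that adding variance [del ^+ 2] and shifting by [M * del] moves the
   limit by at most [eps / 3]. *)
pose del := Num.min 1 (eps / 3 / (C * (1 + M) + 1)).
have D0 : 0 < C * (1 + M) + 1 by rewrite ltr_wpDl// mulr_ge0// addr_ge0// ltW.
have del0 : 0 < del by rewrite lt_min ltr01 divr_gt0.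
have del1 : del <= 1 by rewrite ge_min lexx.
have delC : C * (del ^+ 2 + M * del) <= eps / 3.
  have : del * (C * (1 + M) + 1) <= eps / 3.
    by rewrite -ler_pdivlMr// ge_min lexx orbT.
  have : C * del ^+ 2 <= C * del by rewrite ler_wpM2l// expr2 ler_piMr// ltW.
  lra.
have e0 : 0 < del ^+ 2 by rewrite exprn_gt0.
(* [B] may blow up for small [del]; it enters only the rate [L], and [j] is chosen after [del]. *)
have [B B0 [b2 b0 b2l bt]] := G_lipschitz e0.
have [L HL] : exists L : R, forall y j, `|law p a b j.+1 (fun _ s =>
    G0 (del ^+ 2) (y - (Num.sqrt j.+3%:R)^-1 * (s - j.+3%:R * drift)))
    - G0 (del ^+ 2 + avar) y| <= L * (Num.sqrt j.+3%:R)^-1.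
  by eexists => z j; apply: (law_heat_flow p01 sa sb B0 b2 b0 b2l bt).
have rse : rsqrt (del ^+ 2) = del^-1 by rewrite /rsqrt sqrtr_sqr gtr0_norm.
have Gshift (z : R) : `|z - y| <= M * del ->
    `|G0 (del ^+ 2 + avar) z - G0 avar y| <= eps / 3.
  move=> zy; rewrite (le_trans (Glip _ _ _ _ _ _))//.
    by rewrite lerDr ltW.
  rewrite addrK (ger0_norm (ltW e0)) (le_trans _ delC)//.
  by apply: ler_wpM2l => //; rewrite lerD2l.
have Mdel : `|M * del| = M * del by rewrite ger0_norm// mulr_ge0// ltW.
near=> j.
pose c : R := (Num.sqrt j.+3%:R)^-1.
have Lc : L * c <= eps / 3.
  pose r := `|L| / (eps / 3).
  have rn : r ^+ 2 <= j.+3%:R.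
    apply: (@le_trans _ _ j%:R); last by rewrite ler_nat -addn3 leq_addr.
    by near: j; exact: nbhs_infty_ger.
  have : r <= Num.sqrt j.+3%:R.
    by rewrite (le_trans (ler_norm _))// -sqrtr_sqr ler_wsqrtr.
  rewrite /c ler_pdivrMr// => rle; rewrite ler_pdivrMr ?sqrtr_gt0//.
  by rewrite (le_trans (ler_norm _))// mulrC.
rewrite -/(G0 avar y) distrC ler_distl; apply/andP; split.
- have h1 := Gshift (y - M * del); have h2 := HL (y - M * del) j.
  (* Where the indicator vanishes, the test function shifted left by [M * del] is at most
     [Phi (- M)]. *)
  have : law p a b j.+1 (fun _ s => G0 (del ^+ 2)
      (y - M * del - (Num.sqrt j.+3%:R)^-1 * (s - j.+3%:R * drift))) <=
    law p a b j.+1 (fun _ s =>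
      ((s - j.+3%:R * drift) / Num.sqrt j.+3%:R <= y)%R%:R) + eps / 3.
    apply: law_le => // x s _ _; rewrite /G0 [X in Phi ((_ - X) * _)]mulrC.
    case: (leP ((s - j.+3%:R * drift) / Num.sqrt j.+3%:R) y) => [_|yW].
      by rewrite (le_trans (Phi_le1 _))// lerDl ltW.
    rewrite add0r (le_trans _ PhiNM)// Phi_nd// rse ler_pdivrMr//.
    by rewrite mulNr; lra.
  move: h1 h2; rewrite -/c; have -> : y - M * del - y = - (M * del) by ring.
  rewrite normrN Mdel => /(_ (lexx _)).
  rewrite !ler_distl => /andP[h1 _] /andP[h2 _] h3.
  lra.
- have h1 := Gshift (y + M * del); have h2 := HL (y + M * del) j.
  (* Where the indicator is 1, the test function shifted right by [M * del] is at least [Phi M]. *)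
  have : law p a b j.+1 (fun _ s =>
      ((s - j.+3%:R * drift) / Num.sqrt j.+3%:R <= y)%R%:R) <=
    law p a b j.+1 (fun _ s => G0 (del ^+ 2)
      (y + M * del - (Num.sqrt j.+3%:R)^-1 * (s - j.+3%:R * drift))) + eps / 3.
    apply: law_le => // x s _ _; rewrite /G0 [X in Phi ((_ - X) * _)]mulrC.
    case: (leP ((s - j.+3%:R * drift) / Num.sqrt j.+3%:R) y) => [Wy|_];
      last by rewrite addr_ge0 ?Phi_ge0 ?ltW.
    rewrite -lerBlDr (le_trans PhiM)// Phi_nd// rse ler_pdivlMr//.
    by lra.
  move: h1 h2; rewrite -/c; have -> : y + M * del - y = M * del by ring.
  rewrite Mdel => /(_ (lexx _)).
  rewrite !ler_distl => /andP[_ h1] /andP[_ h2] h3.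
  lra.
Unshelve. all: by end_near.
Qed.

End normal_limit.

(** * Linearity of the conditional law *)

Section law_linear.
Context {R : realType} (p a b : R).
Implicit Types f g : R -> R -> R.

Lemma law_linear j u v f g :
  law p a b j (fun x s => u * f x s + v * g x s) =
  u * law p a b j f + v * law p a b j g.
Proof.
elim: j f g => //= j IH f g; rewrite -IH; congr law.
apply/funext => x; apply/funext => s.
rewrite /remember (mulrCA u) (mulrCA v) -mulrDr; congr (_ * _).
rewrite !mulr_sumr -big_split/=; apply: eq_bigr => z _; ring.
Qed.

Lemma law_sum (I : eqType) (r : seq I) j u (F : I -> R -> R -> R) :
  law p a b j (fun x s => u * \sum_(i <- r) F i x s) =
  u * \sum_(i <- r) law p a b j (F i).
Proof.
elim: r => [|i r IH].
  under eq_fun do under eq_fun do rewrite big_nil mulr0.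
  by rewrite big_nil mulr0 law_cst.
under eq_fun do under eq_fun do rewrite big_cons mulrDr -[X in _ + X]mul1r.
by rewrite law_linear IH mul1r big_cons mulrDr.
Qed.

End law_linear.

(** * Real-valued probabilities and finite additivity *)

Section finite_probability.
Context d (T : measurableType d) (R : realType) (P : probability T R).

Definition pr (A : set T) : R := fine (P A).

Lemma prE A : measurable A -> P A = (pr A)%:E.
Proof. by move=> mA; rewrite fineK// fin_num_measure. Qed.

Lemma pr0 : pr set0 = 0.
Proof. by rewrite /pr measure0. Qed.

Lemma prT : pr setT = 1.
Proof. by rewrite /pr probability_setT. Qed.

Lemma prS A B : measurable A -> measurable B -> A `<=` B -> pr A <= pr B.
Proof. by move=> mA mB AB; rewrite -lee_fin -!prE// le_measure ?inE. Qed.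

Lemma prU A B : measurable A -> measurable B -> A `&` B = set0 ->
  pr (A `|` B) = pr A + pr B.
Proof.
move=> mA mB AB; apply: EFin_inj; rewrite EFinD -!prE//; last exact: measurableU.
exact: measureU.
Qed.

Lemma pr_bigU (I : choiceType) (r : seq I) (F : I -> set T) C :
  uniq r -> measurable C -> (forall i, i \in r -> measurable (F i)) ->
  (forall i j w, i \in r -> j \in r -> F i w -> F j w -> i = j) ->
  pr ((\big[setU/set0]_(i <- r) F i) `&` C) = \sum_(i <- r) pr (F i `&` C).
Proof.
move=> + mC; elim: r => [|i r IH]; first by rewrite !big_nil set0I pr0.
move=> /andP[ir ur] mF dis; rewrite !big_cons setIUl prU.
- rewrite IH// => [k kr|k l w kr lr]; first by apply: mF; rewrite inE kr orbT.
  by apply: dis; rewrite inE ?kr ?lr orbT.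
- by apply: measurableI => //; apply: mF; rewrite mem_head.
- apply: measurableI => //; rewrite big_seq.
  by apply: bigsetU_measurable => k kr; apply: mF; rewrite inE kr orbT.
- rewrite -subset0 => w [[Fi _] [+ _]]; rewrite -bigcup_seq => -[k /= kr Fk].
  have ik : i = k by apply: (dis _ _ w) => //; rewrite inE ?eqxx// kr orbT.
  by rewrite ik kr in ir.
Qed.

End finite_probability.

(** * From the random walk to the conditional laws *)

Section bridge.
Context d (T : measurableType d) (R : realType) (P : probability T R) (p : R).
Context (X : nat -> {RV P >-> R}) (K : nat -> {RV P >-> nat})
  (eps : nat -> {RV P >-> R}).
Hypothesis erwX : elephant_first_two_last p X K eps.

Local Notation pr := (pr P).
Local Notation source := (option (nat + nat)).

Lemma sigma_of_measurable d' (T' : measurableType d') (f : {mfun T >-> T'}) A :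
  sigma_of f A -> measurable A.
Proof. by case=> B mB <-; rewrite setTI; exact: measurable_funPTI. Qed.

Lemma erw_sources_measurable i A : erw_sources X K eps i A -> measurable A.
Proof. by case: i => [[n|n]|] /=; exact: sigma_of_measurable. Qed.

Lemma sigma_of_eq d' (T' : measurableType d') (f : {mfun T >-> T'}) (t : T') :
  measurable [set t] -> sigma_of f [set w | f w = t].
Proof. by move=> mt; exists [set t] => //; rewrite setTI. Qed.

Lemma measurable_eq d' (T' : measurableType d') (f : {mfun T >-> T'}) (t : T') :
  measurable [set t] -> measurable [set w | f w = t].
Proof. by move=> mt; exact: sigma_of_measurable (sigma_of_eq f mt). Qed.

Lemma pr_sources (J : {fset source}) (A : source -> set T) :
  (forall i, i \in J -> erw_sources X K eps i (A i)) ->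
  pr (\bigcap_(i in [set` J]) A i) = \prod_(i <- J) pr (A i).
Proof.
move=> JA; rewrite /pr (erw_independent erwX JA) big_seq.
rewrite (eq_bigr (fun i => (pr (A i))%:E)); last first.
  by move=> i iJ; rewrite -prE//; exact/erw_sources_measurable/JA.
by rewrite prodEFin /= [RHS]big_seq.
Qed.

(* The sources that do not enter the first [j.+2] steps. *)
Definition future (j : nat) (i : source) : bool :=
  match i with
  | None => false
  | Some (inl n) => (j <= n)%N
  | Some (inr n) => (j < n)%N
  end.

Definition candidates (j : nat) : seq nat :=
  if j is 0%N then [:: 1; 2]%N else [:: 1; 2; j.+2]%N.

(** Every index other than 1 and 2 means the last step; among [candidates j] only [j.+2] with
    [j > 0] is of that kind. *)
Definition recalled (a b x : R) (k : nat) : R :=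
  if k == 1%N then a else if k == 2%N then b else x.

(* The event that [B X_(j+2) S_(j+2)] holds, that the first two steps are [a] and
   [b] and that all choices up to that time lie in their nominal ranges. As a
   finite union of cylinders it is measurable for arbitrary [B]; that nothing of
   positive probability is lost follows from the total mass in [pr_law]. *)
Fixpoint history (a b : R) (j : nat) (B : R -> R -> bool) : set T :=
  match j with
  | 0%N => [set w | [/\ X 1%N w = a, eps 1%N w = a * b & B b (a + b)]]
  | j'.+1 =>
      let piece k e := history a b j'
            (fun x s => B (e * recalled a b x k) (s + e * recalled a b x k))
          `&` ([set w | K j'.+2 w = k] `&` [set w | eps j'.+2 w = e]) in
      \big[setU/set0]_(k <- candidates j') (piece k 1 `|` piece k (-1))
  end.

Lemma history_measurable a b j B : measurable (history a b j B).
Proof.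
elim: j B => [|j IH] B /=.
  case: (B b (a + b)); last first.
    by rewrite (_ : [set w | _] = set0)//; apply/seteqP; split => // w [].
  rewrite (_ : [set w | _] = [set w | X 1%N w = a] `&` [set w | eps 1%N w = a * b]).
    by apply: measurableI; exact: measurable_eq.
  by apply/seteqP; split => w [].
apply: bigsetU_measurable => k _; apply: measurableU; apply: measurableI => //;
  by apply: measurableI; exact: measurable_eq.
Qed.

(** On [history], [eps 1 = a * b] forces [X 2 = a * b * a = b] since [a] is a sign; later steps
    follow the recursion with the recorded choices. *)
Lemma history_sub a b j B w : is_sign a -> history a b j B w ->
  [/\ X 1%N w = a, X 2%N w = b & B (X j.+2 w) (erw_position X j.+2 w)].
Proof.
move=> sa; elim: j B => [|j IH] B /=.
  move=> [X1 e1 Bab]; have X2 : X 2%N w = b.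
    rewrite (erw_step2 erwX) X1 e1 mulrAC.
    by move: sa => /orP[]/eqP->; ring.
  split=> //; rewrite /erw_position big_nat_recr//= big_nat1.
  by rewrite X1 X2.
rewrite -bigcup_seq => -[k /= kj].
have step e : (history a b j
    (fun x s => B (e * recalled a b x k) (s + e * recalled a b x k)) `&`
    ([set w | K j.+2 w = k] `&` [set w | eps j.+2 w = e])) w ->
  [/\ X 1%N w = a, X 2%N w = b & B (X j.+3 w) (erw_position X j.+3 w)].
  move=> [/IH[X1 X2 BX] [/= Kk ee]]; split=> //.
  rewrite /erw_position big_nat_recr//=.
  rewrite (erw_step erwX)// Kk ee.
  suff -> : X k w = recalled a b (X j.+2 w) k by [].
  rewrite /recalled.
  case: eqP => [->//|k1]; case: eqP => [->//|k2].
  case: (j) kj => [|i]; rewrite !inE; first by case/orP => /eqP.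
  by case/or3P => /eqP // ->.
by case=> /step.
Qed.

Lemma candidatesE a b x j :
  map (recalled a b x) (candidates j) = if j is 0%N then [:: a; b] else [:: a; b; x].
Proof. by case: j. Qed.

(** The arbitrary events [A i] of future sources make the induction work: the memory and sign
    choices of the last step are future for the shorter history, so they are added to [J] and factor
    out by independence. *)
Lemma pr_history a b j B (J : {fset source}) (A : source -> set T) :
  (forall i, i \in J -> future j i /\ erw_sources X K eps i (A i)) ->
  pr (history a b j B `&` \bigcap_(i in [set` J]) A i) =
  pr [set w | X 1%N w = a] * pr [set w | eps 1%N w = a * b] *
  law p a b j (fun x s => (B x s)%:R) * \prod_(i <- J) pr (A i).
Proof.
elim: j B J A => [|j IH] B J A JA /=.
  case: (B b (a + b)); last first.
    rewrite (_ : [set w | _] = set0); last by apply/seteqP; split => // w [].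
    by rewrite set0I pr0 mulr0 mul0r.
  (* Neither source of the first two steps lies in [J], so both can be added to the family without
     touching the given events. *)
  pose A' i := match i with None => [set w | X 1%N w = a]
    | Some (inr 0%N) => [set w | eps 1%N w = a * b] | _ => A i end.
  have nJ : None \notin J by apply/negP => /JA[].
  have iJ : Some (inr 0%N) \notin J by apply/negP => /JA[].
  have niJ : None \notin (Some (inr 0%N) |` J)%fset by rewrite !inE negb_or nJ.
  have AA' i : i \in J -> A i = A' i.
    by case: i => [[n|[|n]]|] //= h; [rewrite h in iJ|rewrite h in nJ].
  have -> : [set w | [/\ X 1%N w = a, eps 1%N w = a * b & true]] `&`
      \bigcap_(i in [set` J]) A i =
      \bigcap_(i in [set` (None |` (Some (inr 0%N) |` J))%fset]) A' i.
    rewrite !bigcap_fsetU1 (eq_bigcapr AA').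
    by apply/seteqP; split => w; [move=> [[]]|move=> [? []]].
  rewrite pr_sources; last first.
    move=> i; rewrite !inE => /or3P[/eqP->|/eqP->|iJ'] /=.
    - exact: sigma_of_eq.
    - exact: sigma_of_eq.
    - by rewrite -AA'//; have [] := JA _ iJ'.
  rewrite !big_fsetU1//= mulr1 mulrA; congr (_ * _).
  by rewrite !big_seq; apply: eq_bigr => i h; rewrite AA'.
pose C := \bigcap_(i in [set` J]) A i.
have mC : measurable C.
  by apply: fin_bigcap_measurable => // i /JA[_]; exact: erw_sources_measurable.
pose Bk k e x s := B (e * recalled a b x k) (s + e * recalled a b x k).
pose F k e : set T := history a b j (Bk k e) `&`
  ([set w | K j.+2 w = k] `&` [set w | eps j.+2 w = e]).
have mF k e : measurable (F k e).
  apply: measurableI; first exact: history_measurable.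
  by apply: measurableI; exact: measurable_eq.
pose n : R := (size (candidates j))%:R^-1.
pose c := pr [set w | X 1%N w = a] * pr [set w | eps 1%N w = a * b].
pose Q := \prod_(i <- J) pr (A i).
have prF k e : k \in candidates j -> pr (F k e `&` C) =
    c * law p a b j (fun x s => (Bk k e x s)%:R) *
    (n * (pr [set w | eps j.+2 w = e] * Q)).
  move=> kj.
  pose A' (i : source) := if i == Some (inl j) then [set w | K j.+2 w = k]
    else if i == Some (inr j.+1) then [set w | eps j.+2 w = e] else A i.
  have lJ : Some (inl j) \notin J by apply/negP => /JA[]; rewrite /= ltnn.
  have rJ : Some (inr j.+1) \notin J by apply/negP => /JA[]; rewrite /= ltnn.
  have lrJ : Some (inl j) \notin (Some (inr j.+1) |` J)%fset.
    by rewrite !inE negb_or lJ.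
  have AA' i : i \in J -> A i = A' i.
    rewrite /A' => h; case: eqP => [ij|_]; first by rewrite ij (negbTE lJ) in h.
    by case: eqP => [ij|//]; rewrite ij (negbTE rJ) in h.
  have -> : F k e `&` C = history a b j (Bk k e) `&`
      \bigcap_(i in [set` (Some (inl j) |` (Some (inr j.+1) |` J))%fset]) A' i.
    by rewrite !bigcap_fsetU1 /F /C (eq_bigcapr AA') /A' !eqxx -!setIA.
  rewrite IH; last first.
    move=> i; rewrite !inE => /or3P[/eqP->|/eqP->|iJ].
    - by split => //=; rewrite /A' eqxx; exact: sigma_of_eq.
    - by split => //=; rewrite /A' eqxx; exact: sigma_of_eq.
    - have [iF iA] := JA _ iJ; split; last by rewrite -AA'.
      by case: i iF {iJ iA} => [[m|m]|] //=; [exact: ltnW|exact: ltnW].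
  rewrite !big_fsetU1//= -/c /Q; congr (_ * _).
  have -> : pr (A' (Some (inl j))) = n.
    rewrite /A' eqxx /pr /n.
    by case: (j) kj => [|i] kj; rewrite ?(erw_memory2 erwX kj) ?(erw_memory erwX _ kj).
  rewrite {1}/A' /= eqxx; congr (_ * (_ * _)).
  by rewrite !big_seq; apply: eq_bigr => i h; rewrite AA'.
have [pp pn] := @erw_sign _ _ _ _ _ _ _ _ erwX j.+2 isT.
have prp : pr [set w | eps j.+2 w = 1] = p by rewrite /pr pp.
have prn : pr [set w | eps j.+2 w = -1] = 1 - p by rewrite /pr pn.
rewrite -/C -/c -/Q.
transitivity (\sum_(k <- candidates j) pr ((F k 1 `|` F k (-1)) `&` C)).
  apply: pr_bigU => //.
  - by case: (j) => [|i].
  - by move=> k _; apply: measurableU; exact: mF.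
  - by move=> k k' w _ _ [[_ [<- _]]|[_ [<- _]]] [[_ [<- _]]|[_ [<- _]]].
(* By linearity, averaging over the remembered step and the sign inside the law equals averaging the
   laws over [k] and [e], which matches the disjoint pieces. *)
have -> : law p a b j (fun x s => remember p
      (match j with 0%N => [:: a; b] | _.+1 => [:: a; b; x] end)
      (fun x0 s0 => (B x0 s0)%:R) s) =
    n * \sum_(k <- candidates j)
      (p * law p a b j (fun x s => (Bk k 1 x s)%:R) +
       (1 - p) * law p a b j (fun x s => (Bk k (-1) x s)%:R)).
  under [X in _ = _ * X]eq_bigr do rewrite -law_linear.
  rewrite -law_sum; congr law; apply/funext => x; apply/funext => s.
  rewrite -candidatesE /remember size_map big_map -/n; congr (_ * _).
  by apply: eq_bigr => k _; rewrite /Bk !mul1r !mulN1r.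
rewrite mulrA [c * n]mulrC -!mulrA big_distrl/= !mulr_sumr.
rewrite !big_seq; apply: eq_bigr => k kj.
rewrite setIUl prU.
- by rewrite !prF// prp prn /c; ring.
- exact: measurableI.
- exact: measurableI.
- apply/seteqP; split => // w [[[_ [_ /= e1]] _] [[_ [_ /= e2]] _]].
  by move: e2; rewrite e1 => /eqP; rewrite -addr_eq0 (_ : 1 + 1 = 2)// pnatr_eq0.
Qed.

Definition signs : seq (R * R) := [:: (1, 1); (1, -1); (-1, 1); (-1, -1)].

Lemma sign_pairs ab : ab \in signs -> is_sign ab.1 && is_sign ab.2.
Proof. by rewrite !inE => /or4P[]/eqP-> /=; rewrite /is_sign !eqxx ?orbT. Qed.

Let weight (ab : R * R) : R :=
  pr [set w | X 1%N w = ab.1] * pr [set w | eps 1%N w = ab.1 * ab.2].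

(** The grouping is by whether [X 2 = X 1], an event of probability [p]; this gives the weights of
    the mixture. *)
Lemma sum_signs (F : R * R -> R) : \sum_(ab <- signs) weight ab * F ab =
  p * (p * F (1, 1) + (1 - p) * F (-1, -1)) +
  (1 - p) * (p * F (1, -1) + (1 - p) * F (-1, 1)).
Proof.
have [Xp Xn] := erw_first erwX; have [ep en] := erw_sign erwX (leqnn 1).
rewrite !big_cons big_nil /weight /= !mulr1 mulrNN mulr1 mul1r.
rewrite /pr Xp Xn ep en /=. ring.
Qed.

(** The histories for [B] lie inside [E] and those for its negation inside the complement. Their
    probabilities already add up to 1, so both inclusions are equalities in probability. *)
Lemma pr_law (E : set T) (B : R -> R -> R -> R -> bool) j : measurable E ->
  (forall w, E w <-> B (X 1%N w) (X 2%N w) (X j.+2 w) (erw_position X j.+2 w)) ->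
  pr E = \sum_(ab <- signs)
    weight ab * law p ab.1 ab.2 j (fun x s => (B ab.1 ab.2 x s)%:R).
Proof.
move=> mE EB.
pose H (B : R -> R -> R -> R -> bool) : set T :=
  \big[setU/set0]_(ab <- signs) history ab.1 ab.2 j (B ab.1 ab.2).
have usigns : uniq signs.
  have n11 : (1 == -1 :> R) = false.
    by apply/negbTE; rewrite -addr_eq0 (_ : 1 + 1 = 2)// pnatr_eq0.
  by rewrite /signs /= !inE !xpair_eqE !eqxx n11 [-1 == 1]eq_sym n11.
have mH B' : measurable (H B').
  by apply: bigsetU_measurable => ab _; exact: history_measurable.
have HE B' w : H B' w ->
    B' (X 1%N w) (X 2%N w) (X j.+2 w) (erw_position X j.+2 w).
  rewrite /H -bigcup_seq => -[[a b] /= /sign_pairs/andP[sa sb]].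
  by case/(history_sub sa) => -> ->.
have prH B' : pr (H B') = \sum_(ab <- signs)
    weight ab * law p ab.1 ab.2 j (fun x s => (B' ab.1 ab.2 x s)%:R).
  rewrite -[H B']setIT pr_bigU//.
  - apply: eq_bigr => ab _.
    have := @pr_history ab.1 ab.2 j (B' ab.1 ab.2) fset0 (fun=> setT).
    by rewrite big_seq_fset0 mulr1 set_fset0 bigcap_set0; apply.
  - by move=> ab _; exact: history_measurable.
  - move=> [a b] [a' b'] w /sign_pairs/= /andP[sa _] /sign_pairs/= /andP[sa' _].
    by move=> /(history_sub sa)[<- <- _] /(history_sub sa')[<- <- _].
pose nB x1 x2 x s := ~~ B x1 x2 x s.
have HnE : H nB `<=` ~` E by move=> w /HE; rewrite /nB => /negP nE /EB.
have HsE : H B `<=` E by move=> w /HE /EB.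
(* The indicators of [B] and of its negation add up to 1, and each conditional law has total mass
   1. *)
have Htot : pr (H B) + pr (H nB) = 1.
  rewrite !prH -big_split/= (eq_bigr (fun ab => weight ab * 1)).
    by rewrite sum_signs; ring.
  move=> ab _; rewrite -mulrDr; congr (_ * _).
  rewrite -[X in X + _]mul1r -[X in _ + X]mul1r -law_linear -[RHS](law_cst p ab.1 ab.2 j).
  congr law; apply/funext => x; apply/funext => s.
  by rewrite /nB; case: (B _ _ _ _); rewrite /= ?mulr0 ?mulr1 ?addr0 ?add0r.
have mnE : measurable (~` E) by exact: measurableC.
have EnE : pr E + pr (~` E) = 1.
  by rewrite -prU// ?setUv ?prT// setICr.
have h1 := prS P (mH _) mE HsE.
have h2 := prS P (mH _) mnE HnE.
by rewrite -prH; lra.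
Qed.

End bridge.

(** * Averaging over the four pairs of first steps *)

Unset Implicit Arguments.

Theorem theorem11p2 (R : realType) (d : measure_display) (T : measurableType d)
    (P : probability T R) (p : R) (X : nat -> {RV P >-> R})
    (K : nat -> {RV P >-> nat}) (eps : nat -> {RV P >-> R})
    (p01 : 0 < p < 1) (erwX : elephant_first_two_last p X K eps) :
  cvg_in_distribution (fun n => erw_normalized p X n : {RV P >-> R})
    (mixture_df p (normal_df (sigmaT2 p)) (normal_df ((1 + p) / (2 - p)))).
Proof.
have /andP[p0 p1] := p01.
have p2 : 2 - p != 0 by rewrite gt_eqF//; lra.
(* Equal first steps give [sigmaT2 p]; opposite ones give zero drift, hence [(1 + p) / (2 - p)]. *)
have av_eq : avar p 1 1 = sigmaT2 p.
  by rewrite /avar /drift /sigmaT2; field.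
have av_eqN : avar p (-1) (-1) = sigmaT2 p.
  by rewrite /avar /drift /sigmaT2; field.
have av_ne : avar p 1 (-1) = (1 + p) / (2 - p).
  by rewrite /avar /drift; field.
have av_neN : avar p (-1) 1 = (1 + p) / (2 - p).
  by rewrite /avar /drift; field.
have s1 : is_sign (1 : R) by rewrite /is_sign eqxx.
have sN1 : is_sign (-1 : R) by rewrite /is_sign eqxx orbT.
have sig0 : 0 < sigmaT2 p by rewrite -av_eq; exact: avar_gt0.
have sig0' : 0 < (1 + p) / (2 - p) by rewrite -av_ne; exact: avar_gt0.
(* The shift by 3 matches the conditional limits, which are stated at time [j.+3]. *)
move=> x _; rewrite /mixture_df !normal_dfE// -!EFinM -EFinD -(cvg_shiftn 3).
pose L (ab : R * R) j := law p ab.1 ab.2 j.+1 (fun _ s =>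
    ((s - j.+3%:R * drift p ab.1 ab.2) / Num.sqrt j.+3%:R <= x)%R%:R).
have cdfE j : cdf (erw_normalized p X (j + 3)%N : {RV P >-> R}) x =
    (p * (p * L (1, 1) j + (1 - p) * L (-1, -1) j) +
     (1 - p) * (p * L (1, -1) j + (1 - p) * L (-1, 1) j))%:E.
  have EE : [set w | erw_normalized p X j.+3 w <= x] =
      (erw_normalized p X j.+3 : {RV P >-> R}) @^-1` `]-oo, x].
    by apply/seteqP; split => w; rewrite /= in_itv.
  have mE : measurable [set w | erw_normalized p X j.+3 w <= x].
    by rewrite EE; exact: measurable_funPTI.
  rewrite addn3 -(sum_signs erwX (L ^~ j)).
  (* Once [X 1] and [X 2] are fixed, the random centring is the constant [drift p a b]. *)
  rewrite -(@pr_law _ _ _ _ _ _ _ _ erwX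
    [set w | erw_normalized p X j.+3 w <= x]
    (fun a b _ s => (s - j.+3%:R * drift p a b) / Num.sqrt j.+3%:R <= x)).
  - by rewrite -prE// EE.
  - by [].
  - by move=> w /=; rewrite /erw_normalized [_ * j.+3%:R]mulrC.
rewrite /= (eq_cvg _ _ cdfE).
have LP (a b : R) : is_sign a -> is_sign b ->
  L (a, b) j @[j --> \oo] --> Phi (x * rsqrt (avar p a b)).
  by move=> sa sb; exact: (@law_cvg_normal R p a b p01 sa sb x).
apply: cvg_EFin; first exact: nearW.
(* Each component is split by the value of [X 1], with weights [p] and [1 - p] adding up to 1. *)
have -> : p * Phi (x * rsqrt (sigmaT2 p)) + (1 - p) * Phi (x * rsqrt ((1 + p) / (2 - p)))
  = p * (p * Phi (x * rsqrt (avar p 1 1)) +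
         (1 - p) * Phi (x * rsqrt (avar p (-1) (-1)))) +
    (1 - p) * (p * Phi (x * rsqrt (avar p 1 (-1))) +
               (1 - p) * Phi (x * rsqrt (avar p (-1) 1))).
  by rewrite av_eq av_eqN av_ne av_neN; ring.
by apply: cvgD; apply: cvgMr; apply: cvgD; apply: cvgMr; exact: LP.
Qed.
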